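(* For every stochastic $K$-armed bandit ($K\ge2$) with reward distributions supported on $[0,1]$ and means $\mu_1\ge\cdots\ge\mu_K$, the KL-MS algorithm satisfies \[ \limsup_{T\to\infty}\frac{\mathrm{Reg}(T)}{\ln T}\le\sum_{a\in[K]:\Delta_a>0}\frac{\Delta_a}{\mathsf{kl}(\mu_a,\mu_1)}. \]
   Context: Bandit model: arm $i\in[K]$ has reward distribution $\nu_i$ on $[0,1]$ with mean $\mu_i$, indexed so $\mu_1\ge\cdots\ge\mu_K$. At round $t$ the learner picks $I_t$ and observes $y_t\sim\nu_{I_t}$ independently of the past given $I_t$. $N_{t,a}$ = number of pulls of arm $a$ in rounds $1..t$; $\hat\mu_{t,a}$ = empirical mean of arm $a$'s rewards up to round $t$; $\hat\mu_{t,\max}=\max_a\hat\mu_{t,a}$; $\Delta_a=\mu_1-\mu_a$; $\mathrm{Reg}(T)=T\mu_1-\mathbb E\sum_{t=1}^Ty_t$. $\mathsf{kl}(p,q)=p\ln\frac pq+(1-p)\ln\frac{1-p}{1-q}$ (a term with $\mathsf{kl}=+\infty$ contributes $0$). KL-MS: for $t\le K$ pull arm $t$; for $t\ge K+1$ pull $I_t\sim p_t$ with $p_{t,a}\propto\exp(-N_{t-1,a}\,\mathsf{kl}(\hat\mu_{t-1,a},\hat\mu_{t-1,\max}))$. *)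

(* Defs.v *)
From HB Require Import structures.
From mathcomp Require Import all_boot all_order all_algebra.
From mathcomp Require Import all_classical all_reals all_analysis.
Set Implicit Arguments. Unset Strict Implicit. Unset Printing Implicit Defensive.
Import Order.TTheory GRing.Theory Num.Theory.
Local Open Scope ring_scope.
Local Open Scope ereal_scope.

Section Bandit.
Variable R : realType.

Definition kl_term (p q : R) : \bar R :=
  if p == 0%R then 0 else if q == 0%R then +oo else (p * ln (p / q))%:E.

Definition kl (p q : R) : \bar R := kl_term p q + kl_term (1 - p)%R (1 - q)%R.

Variable K : nat.
Definition history := seq ('I_K * R).

Definition npulls (h : history) (a : 'I_K) : nat := count (fun x => x.1 == a) h.

Definition muhat (h : history) (a : 'I_K) : R :=
  if npulls h a == 0%N then 0%R
  else ((\sum_(x <- h | x.1 == a) x.2) / (npulls h a)%:R)%R.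

(* max_a muhat a ; a0 is any arm, used as the seed of the max *)
Definition muhat_max (a0 : 'I_K) (h : history) : R :=
  \big[Num.max/muhat h a0]_(a < K) muhat h a.

Definition klms_weight (a0 : 'I_K) (h : history) (a : 'I_K) : R :=
  match kl (muhat h a) (muhat_max a0 h) with
  | r%:E => expR (- ((npulls h a)%:R * r))
  | _ => 0%R
  end.

(* KL-MS sampling probability of arm a at the round following history h
   (round t = size h + 1): for t <= K pull arm t (index size h, 0-based),
   otherwise p_{t,a} proportional to exp(-N_{t-1,a} kl(muhat_a, muhat_max)). *)
Definition klms_policy (a0 : 'I_K) (h : history) (a : 'I_K) : R :=
  if (size h < K)%N then ((val a == size h)%:R)%R
  else (klms_weight a0 h a / \sum_(b < K) klms_weight a0 h b)%R.

Variable nu : 'I_K -> probability R R.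

(* Expected total reward collected during the next n rounds when the
   learner follows policy pol, starting from history h:
   E[sum y] = sum_a p(h)_a  int nu_a(dy) (y + E[future | h ++ (a,y)]). *)
Fixpoint exp_reward (pol : history -> 'I_K -> R) (n : nat) (h : history)
  : \bar R :=
  match n with
  | 0%N => 0
  | n'.+1 => \sum_(a < K) (pol h a)%:E *
             \int[nu a]_y (y%:E + exp_reward pol n' (rcons h (a, y)))
  end.

Definition arm_mean (a : 'I_K) : R := fine (\int[nu a]_y y%:E).

End Bandit.

(* arm 1 (0-based index 0), given K >= 2 *)
Definition arm1 (K : nat) (HK : (1 < K)%N) : 'I_K := Ordinal (ltnW HK).

Definition klms_regret (R : realType) (K : nat) (HK : (1 < K)%N)
  (nu : 'I_K -> probability R R) (T : nat) : \bar R :=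
  (T%:R * arm_mean nu (arm1 HK))%:E
  - exp_reward nu (klms_policy (arm1 HK)) T [::].

Definition lai_robbins_const (R : realType) (K : nat) (HK : (1 < K)%N)
  (nu : 'I_K -> probability R R) : R :=
  let mu := arm_mean nu in
  let mu1 := mu (arm1 HK) in
  (\sum_(a < K | 0 < mu1 - mu a)
     match kl (mu a) mu1 with r%:E => (mu1 - mu a) / r | _ => 0 end)%R.

(* Main.v *)
Require Import Defs.
From HB Require Import structures.
From mathcomp Require Import all_boot all_order all_algebra.
From mathcomp Require Import zify ring lra.
From mathcomp Require Import all_classical all_reals all_analysis.
From mathcomp Require Import measurable_realfun.
Import Order.TTheory GRing.Theory Num.Theory.
Import numFieldNormedType.Exports.
Set Implicit Arguments.
Unset Strict Implicit.
Unset Printing Implicit Defensive.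
Local Open Scope ring_scope.
Local Open Scope classical_set_scope.

(**
  Fix a suboptimal arm a, levels x > mu_a and q < mu_1, and u pulls, u ~ ln T / d
  with d close to kl(mu_a, mu_1).  From round K + 1 on, the probability p_a of
  pulling a is bounded in one of four ways:
  - N_a < u, which concerns at most u pulls;
  - muhat_a >= x, in which case an exponential supermartingale of the rewards of a,
    discounted by e^(-c) per pull, is at least 1;
  - muhat_a < x and q <= muhat_max, so that p_a <= exp(- u d) <= 1 / T;
  - muhat_max < q, so that p_a <= p_1 exp(N_1 kl(muhat_1, q)).  As kl(p, q) < kl(p, mu_1)
    for p <= q, compactness of [0, q] gives finitely many tilts (lam, c), c > 0, with
    kl(p, q) <= max (lam p - ln E e^(lam Y) - c), where Y is Bernoulli of mean mu_1:
    the factor is at most a sum of discounted supermartingales of arm 1.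
  Discounting by e^(-c) per pull makes M / (1 - e^(-c)) a potential that pays M at
  each pull, so the four bounds add up to one explicit function of the history and
  of the number of remaining rounds that decreases on average by at least p_a.  Its
  initial value u + 1 + O(1) bounds the number of pulls of a.
*)

(** * Bernoulli divergence *)

Section KullbackLeibler.
Context {R : realType}.
Implicit Types p q m x mu lam r s t e : R.

Lemma ln_le_subr1 x : 0 < x -> ln x <= x - 1.
Proof.
move=> x0; have -> : x = 1 + (x - 1) by ring.
by rewrite (le_trans (le_ln1Dx _))//; lra.
Qed.

Lemma ln_lt_subr1 x : 0 < x -> x != 1 -> ln x < x - 1.
Proof.
move=> x0 x1; rewrite -ltr_expR lnK ?posrE//.
have := @expR_gt1Dx R (x - 1); rewrite subr_eq0 => /(_ x1).
by rewrite [1 + _]addrC subrK.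
Qed.

Definition bern_mgf m lam : R := 1 - m + m * expR lam.

Lemma bern_mgf_gt0 m lam : 0 <= m <= 1 -> 0 < bern_mgf m lam.
Proof.
move=> /andP[m0 m1]; rewrite /bern_mgf.
have := expR_gt0 lam; move: m0; rewrite le_eqVlt => /predU1P[<-|m0] e0.
  by rewrite mul0r; lra.
by have := mulr_gt0 m0 e0; lra.
Qed.

Definition bern_cgf m lam : R := ln (bern_mgf m lam).

Lemma bern_cgf0 m : bern_cgf m 0 = 0.
Proof. by rewrite /bern_cgf /bern_mgf expR0 mulr1 subrK ln1. Qed.

Lemma kl_finE p m : 0 < m < 1 ->
  kl p m = (p * ln (p / m) + (1 - p) * ln ((1 - p) / (1 - m)))%:E.
Proof.
move=> /andP[m0 m1]; rewrite /kl /kl_term (gt_eqF m0).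
have -> : (1 - m == 0) = false by apply/negbTE/lt0r_neq0; lra.
by case: eqVneq => [->|_]; case: eqVneq => [->|_];
  rewrite ?mul0r ?add0e ?adde0 ?add0r ?addr0.
Qed.

(** For [t > 0] this is [ln z <= z - 1] at [z = e * s / t], multiplied by [t]. *)
Lemma mul_ln_ge t s e : 0 <= t -> 0 < s -> 0 < e ->
  t * ln e - t * ln (t / s) <= s * e - t.
Proof.
move=> t0 s0 e0; move: t0; rewrite le_eqVlt => /predU1P[<-|t0].
  by rewrite !mul0r !subr0 mulr_ge0// ltW.
rewrite -mulrBr -ln_div ?posrE ?divr_gt0//.
have -> : s * e - t = t * (e / (t / s) - 1).
  by field; rewrite !gt_eqF.
by rewrite ler_pM2l// ln_le_subr1// !divr_gt0.
Qed.

(* The easy half of the Donsker-Varadhan formula. *)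
Lemma kl_ge_dual p m lam : 0 <= p <= 1 -> 0 <= m <= 1 ->
  ((lam * p - bern_cgf m lam)%:E <= kl p m)%E.
Proof.
move=> /andP[p0 p1] /andP[m0 m1]; have := @bern_mgf_gt0 m lam.
rewrite m0 m1 => /(_ isT) E0.
have [mE|m0'] := eqVneq m 0.
  rewrite /bern_cgf /bern_mgf /kl /kl_term mE mul0r addr0 subr0 ln1 oner_eq0 eqxx.
  case: (eqVneq p 0) => [->|pN0]; last by case: ifP => _; rewrite ?addye ?leey.
  by rewrite !subr0 oner_eq0 divr1 ln1 !mulr0 add0e.
have [mE|m1'] := eqVneq m 1.
  rewrite /bern_cgf /bern_mgf /kl /kl_term mE subrr mul1r add0r eqxx oner_eq0 expRK.
  case: (eqVneq p 0) => [->|pN0]; first by rewrite subr0 oner_eq0 add0e leey.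
  case: (eqVneq (1 - p) 0) => [p1'|_]; last by rewrite addey// leey.
  have -> : p = 1 by lra.
  by rewrite divr1 ln1 adde0 !mulr1 subrr lee_fin.
have m01 : 0 < m < 1 by rewrite lt_neqAle eq_sym m0' m0 lt_neqAle m1' m1.
rewrite kl_finE// lee_fin; case/andP: m01 => m0p m1p.
set E := bern_mgf m lam in E0 *.
(* [expR lam / E] and [E^-1] are the densities of the tilted law with respect to the Bernoulli law
   of mean [m]. They average to 1, so the right-hand sides of the two instances of [mul_ln_ge]
   cancel. *)
have := @mul_ln_ge p m (expR lam / E) p0 m0p (divr_gt0 (expR_gt0 _) E0).
have m1q : 0 < 1 - m by lra.
have Ei : 0 < E^-1 by rewrite invr_gt0.
have p1q : 0 <= 1 - p by lra.
have := @mul_ln_ge (1 - p) (1 - m) E^-1 p1q m1q Ei.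
have -> : ln (expR lam / E) = lam - bern_cgf m lam.
  by rewrite ln_div ?posrE ?expR_gt0// expRK.
rewrite lnV ?posrE// -/E -/(bern_cgf m lam).
have : m * (expR lam / E) + (1 - m) * E^-1 = 1.
  by rewrite mulrA -mulrDl addrC divff// gt_eqF.
rewrite -/E; lra.
Qed.

Lemma kl_ge0 p m : 0 <= p <= 1 -> 0 <= m <= 1 -> (0 <= kl p m)%E.
Proof.
move=> p01 m01; have := kl_ge_dual 0 p01 m01.
by rewrite bern_cgf0 mul0r subr0.
Qed.

(** Linearizing the logarithms of [mu / q] and [(1 - mu) / (1 - q)] bounds the difference of the two
    divergences by [(mu - q) * (q - p) / (q * (1 - q))], which is nonnegative. Strictness comes from
    the second logarithm, whose weight [1 - p] is positive. *)
Lemma kl_lt p q mu : 0 <= p <= q -> 0 < q -> q < mu <= 1 ->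
  (kl p q < kl p mu)%E.
Proof.
move=> /andP[p0 pq] q0 /andP[qmu mu1].
have q01 : 0 < q < 1 by rewrite q0 (lt_le_trans qmu).
rewrite (kl_finE p q01); case/andP: q01 => _ q1.
have [->|mu1'] := eqVneq mu 1.
  rewrite /kl /kl_term subrr eqxx oner_eq0.
  have -> : (1 - p == 0) = false by apply/negbTE/lt0r_neq0; lra.
  by case: ifP => _; rewrite addey// ltry.
have {}mu1 : mu < 1 by rewrite lt_neqAle mu1'.
have mu0 : 0 < mu by lra.
rewrite kl_finE ?mu0// lte_fin.
have p1 : 0 < 1 - p by lra.
have pln : p * (ln (p / q) - ln (p / mu)) = p * ln (mu / q).
  have [->|pn0] := eqVneq p 0; first by rewrite !mul0r.
  have pp : 0 < p by rewrite lt_neqAle eq_sym pn0.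
  by rewrite !ln_div ?posrE//; ring.
have qln : ln ((1 - p) / (1 - q)) - ln ((1 - p) / (1 - mu)) =
   ln ((1 - mu) / (1 - q)).
  by rewrite !ln_div ?posrE; lra.
have h1 : ln (mu / q) <= mu / q - 1 by apply: ln_le_subr1; rewrite divr_gt0.
have h2 : ln ((1 - mu) / (1 - q)) < (1 - mu) / (1 - q) - 1.
  apply: ln_lt_subr1; first by rewrite divr_gt0//; lra.
  by rewrite lt_eqF// ltr_pdivrMr; lra.
have -> : p * ln (p / q) + (1 - p) * ln ((1 - p) / (1 - q)) =
   (p * ln (p / mu) + (1 - p) * ln ((1 - p) / (1 - mu))) +
   (p * ln (mu / q) + (1 - p) * ln ((1 - mu) / (1 - q))).
  by rewrite -qln -pln; ring.
rewrite gtrDl.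
apply: (@lt_le_trans _ _ (p * (mu / q - 1) + (1 - p) * ((1 - mu) / (1 - q) - 1))).
  by rewrite ler_ltD// ?ler_wpM2l// ltr_pM2l.
have -> : p * (mu / q - 1) + (1 - p) * ((1 - mu) / (1 - q) - 1) =
  - ((mu - q) * (q - p) / (q * (1 - q))).
  by field; apply/andP; split; apply/eqP; lra.
by rewrite oppr_le0 divr_ge0// mulr_ge0; lra.
Qed.

Lemma kl_gt0 p mu : 0 <= p < mu -> mu <= 1 -> (0 < kl p mu)%E.
Proof.
move=> /andP[p0 pmu] mu1.
apply: (@le_lt_trans _ _ (kl p ((p + mu) / 2))); last by apply: kl_lt; lra.
by apply: kl_ge0; lra.
Qed.

(** The other half of the duality. For [p > 0] and [mu < 1] the optimal tilt has [expR lam] equal to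
    the odds ratio of [p] and [mu], below 1 because [p < mu]. In the cases [mu = 1] and [p = 0] the
    supremum is only approached as [lam] tends to minus infinity. *)
Lemma kl_lt_dual p mu r : 0 <= p < mu -> mu <= 1 -> (r%:E < kl p mu)%E ->
  exists2 lam, lam < 0 & r < lam * p - bern_cgf mu lam.
Proof.
move=> /andP[p0 pmu] mu1; rewrite /bern_cgf /bern_mgf.
have [mu1E|mu1'] := eqVneq mu 1.
  rewrite {}mu1E in pmu * => _; exists (- ((`|r| + 1) / (1 - p))).
    have r1 : 0 < `|r| + 1 by rewrite ltr_wpDl.
    by rewrite oppr_lt0 divr_gt0 // subr_gt0.
  rewrite subrr mul1r add0r expRK.
  have -> : - ((`|r| + 1) / (1 - p)) * p - - ((`|r| + 1) / (1 - p)) = `|r| + 1.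
    by field; apply/eqP; lra.
  by have := ler_norm r; lra.
have {}mu1 : mu < 1 by rewrite lt_neqAle mu1'.
have mu0 : 0 < mu by lra.
rewrite kl_finE ?mu0//.
have [->|pn0] := eqVneq p 0.
  rewrite mul0r add0r subr0 mul1r mul1r lnV ?posrE ?lte_fin; last by lra.
  move=> rlt.
  have er : 1 - mu < expR (- r).
    by rewrite -[X in X < _](@lnK R) ?posrE ?ltr_expR; lra.
  (* With [s = expR lam], the bound [1 / 2] makes [lam] negative, and the other one keeps
     [1 - mu + mu * s] below [expR (- r)]. *)
  pose s := Num.min (1 / 2) ((expR (- r) - (1 - mu)) / 2).
  have s0 : 0 < s by rewrite lt_min; apply/andP; split; lra.
  exists (ln s).
    by rewrite ln_lt0// s0/= gt_min; apply/orP; left; lra.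
  rewrite lnK ?posrE// mulr0 sub0r ltrNr -ltr_expR lnK ?posrE; last first.
    by have := mulr_gt0 mu0 s0; lra.
  have : s <= (expR (- r) - (1 - mu)) / 2 by rewrite ge_min lexx orbT.
  have : mu * s <= s by rewrite ler_piMl// ltW.
  by lra.
have pp : 0 < p by rewrite lt_neqAle eq_sym pn0.
rewrite lte_fin => rlt.
pose s := (p * (1 - mu)) / (mu * (1 - p)).
have q1 : 0 < 1 - mu by lra.
have p1 : 0 < 1 - p by lra.
have s0 : 0 < s by rewrite divr_gt0// mulr_gt0.
exists (ln s).
  rewrite ln_lt0// s0/= ltr_pdivrMr ?mulr_gt0// mul1r.
  by nra.
rewrite lnK ?posrE//.
have -> : 1 - mu + mu * s = (1 - mu) / (1 - p).
  by rewrite /s; field; rewrite !gt_eqF//.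
apply: (lt_le_trans rlt).
rewrite /s !ln_div ?posrE ?mulr_gt0// !lnM ?posrE//.
lra.
Qed.

(** The cumulant function has slope [mu < x] at 0, so a small enough [lam] works; the explicit one
    satisfies [mu < (1 - lam) * x]. *)
Lemma bern_cgf_lt_mean mu x : 0 <= mu < x ->
  mu <= 1 -> exists2 lam, 0 < lam & bern_cgf mu lam < lam * x.
Proof.
move=> /andP[mu0 mux] mu1.
have x0 : 0 < x by lra.
pose lam := (x - mu) / (2 * x); exists lam.
  by rewrite divr_gt0//; lra.
have lamx : lam * x = (x - mu) / 2 by rewrite /lam; field; rewrite gt_eqF.
have l0 : 0 < lam by rewrite divr_gt0//; lra.
have l1 : lam < 1 by rewrite /lam ltr_pdivrMr; lra.
have eml : expR lam <= (1 - lam)^-1.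
  rewrite -[lam in X in X <= _]opprK expRN lef_pV2 ?posrE ?expR_gt0//; last by lra.
  by have := expR_ge1Dx (- lam); lra.
have e1 : expR lam - 1 <= lam / (1 - lam).
  have -> : lam / (1 - lam) = (1 - lam)^-1 - 1.
    by field; apply/eqP; lra.
  lra.
apply: (@le_lt_trans _ _ (mu * (expR lam - 1))).
  have := @ln_le_subr1 (bern_mgf mu lam); rewrite bern_mgf_gt0 ?mu0// => /(_ isT).
  by rewrite /bern_cgf /bern_mgf; lra.
apply: (@le_lt_trans _ _ (mu * (lam / (1 - lam)))); first by rewrite ler_wpM2l.
rewrite mulrCA ltr_pM2l// ltr_pdivrMr; last lra.
by rewrite mulrBr mulr1 [x * lam]mulrC lamx; lra.
Qed.

End KullbackLeibler.

(** * Finitely many tilts by compactness, and stability of the dual bound *)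

Section Nets.
Context {R : realType}.
Implicit Types p q m x mu lam r s t e : R.

Lemma continuous_mul_ln_div p q : 0 < p -> 0 < q ->
  {for p, continuous (fun t => t * ln (t / q))}.
Proof.
move=> p0 q0; apply: cvgM; first exact: cvg_id.
apply: (@continuous_comp _ _ _ (fun t => t / q) (@ln R)).
  by apply: cvgMr_tmp; exact: cvg_id.
by apply: continuous_ln; rewrite divr_gt0.
Qed.

(** A tilt that is nearly optimal for [kl x mu] exceeds [kl x q] strictly, by [kl_lt]. Half of the
    excess is kept as the discount, and continuity in [p] absorbs the other half. *)
Lemma kl_near_lt_dual q mu x : 0 < q -> q < mu <= 1 -> 0 <= x <= q ->
  exists2 lc : R * R, 0 < lc.2 & \forall p \near x, 0 <= p <= q ->
    (kl p q <= (lc.1 * p - bern_cgf mu lc.1 - lc.2)%:E)%E.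
Proof.
move=> q0 /andP[qmu mu1] /andP[x0 xq].
have q01 : 0 < q < 1 by rewrite q0 (lt_le_trans qmu).
pose k p := p * ln (p / q) + (1 - p) * ln ((1 - p) / (1 - q)).
have klE p : kl p q = (k p)%:E := kl_finE p q01.
have : (kl x q < kl x mu)%E by apply: kl_lt; rewrite ?x0 ?qmu.
rewrite klE => klx.
have [r kr rmu] : exists2 r, k x < r & (r%:E < kl x mu)%E.
  case E : (kl x mu) klx => [z||] //; rewrite ?lte_fin => kz.
    exists ((k x + z) / 2); rewrite ?lte_fin; lra.
  by exists (k x + 1); [lra|rewrite ltry].
have [||lam lam0 rlam] := @kl_lt_dual _ x mu r _ _ rmu; [lra|lra|].
exists (lam, (r - k x) / 2) => /=; first lra.
have cl : {for x, continuous (fun p => lam * p - bern_cgf mu lam - (r - k x) / 2)}.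
  apply: cvgB; last exact: cvg_cst.
  by apply: cvgB; [apply: cvgMl_tmp; exact: cvg_id|exact: cvg_cst].
(* [continuous_mul_ln_div] covers positive points only. At 0 the inequality [k p <= k 0] on [[0, q]]
   replaces continuity of [k]. *)
have [xE|xn0] := eqVneq x 0.
  have cl0 : \forall p \near x, k x < lam * p - bern_cgf mu lam - (r - k x) / 2.
    by apply: (cvgr_gt _ cl); lra.
  near=> p => /andP[p0 pq].
  rewrite klE lee_fin.
  have : k x < lam * p - bern_cgf mu lam - (r - k x) / 2 by near: p.
  suff : k p <= k x by lra.
  rewrite /k xE mul0r add0r !subr0 mul1r.
  have lnp : p * ln (p / q) <= 0.
    by rewrite mulr_ge0_le0// ln_le0// ler_pdivrMr// mul1r.
  have q1 : 0 < 1 - q by lra.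
  have lnq : 0 <= ln (1 / (1 - q)).
    by rewrite ln_ge0// ler_pdivlMr//; lra.
  have : (1 - p) * ln ((1 - p) / (1 - q)) <= (1 - p) * ln (1 / (1 - q)).
    rewrite ler_wpM2l//; first lra.
    by rewrite ler_ln ?posrE ?divr_gt0// ?ler_pM2r ?invr_gt0//; lra.
  have : 0 <= p * ln (1 / (1 - q)) by rewrite mulr_ge0.
  lra.
have xp : 0 < x by rewrite lt_neqAle eq_sym xn0.
have ck : {for x, continuous k}.
  apply: cvgD; first exact: continuous_mul_ln_div.
  apply: (@continuous_comp _ _ _ (fun t => 1 - t) (fun t => t * ln (t / (1 - q)))).
    by apply: cvgB; [exact: cvg_cst|exact: cvg_id].
  by apply: continuous_mul_ln_div; lra.
have kc : \forall p \near x, 0 < lam * p - bern_cgf mu lam - (r - k x) / 2 - k p.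
  have c : {for x, continuous (fun p => lam * p - bern_cgf mu lam - (r - k x) / 2 - k p)}.
    exact: cvgB.
  by apply: (cvgr_gt _ c); lra.
near=> p => _; rewrite klE lee_fin.
suff : 0 < lam * p - bern_cgf mu lam - (r - k x) / 2 - k p by lra.
by near: p.
Unshelve. all: by end_near. Qed.

Lemma kl_le_max_dual q mu : 0 < q -> q < mu <= 1 ->
  exists L : seq (R * R), (forall lc, lc \in L -> 0 < lc.2) /\
  forall p, 0 <= p <= q -> exists2 lc, lc \in L &
    (kl p q <= (lc.1 * p - bern_cgf mu lc.1 - lc.2)%:E)%E.
Proof.
move=> q0 qmu.
pose ok (lc : R * R) p := (kl p q <= (lc.1 * p - bern_cgf mu lc.1 - lc.2)%:E)%E.
pose U (lc : R * R) := interior [set p | 0 <= p <= q -> ok lc p].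
have := @segment_compact R 0 q; rewrite compact_cover.
have oU : forall lc, [set lc : R * R | 0 < lc.2] lc -> open (U lc).
  by move=> lc _; exact: open_interior.
move=> /(_ _ _ U oU)[].
  move=> x; rewrite /= in_itv/= => xq.
  have [lc c0 near_x] := kl_near_lt_dual q0 qmu xq.
  by exists lc.
move=> D D0 cD; exists (finmap.enum_fset D); split.
  by move=> lc lcD; have := D0 _ lcD; rewrite inE.
move=> p pq; have [|lc lcD Up] := cD p; first by rewrite /= in_itv.
by exists lc => //; exact: interior_subset Up _.
Qed.

(** For a fixed tilt the dual value is continuous in both means, so moving each inward by a small
    [s] keeps it above [r]. This leaves room for the estimation errors of both arms. *)
Lemma kl_dual_perturb p mu r : 0 <= p < mu -> mu <= 1 -> (r%:E < kl p mu)%E ->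
  exists lam x q,
  [/\ lam < 0, p < x, 0 < q, q < mu & r <= lam * x - bern_cgf q lam].
Proof.
move=> p0mu mu1 rkl; have [lam lam0 rlam] := kl_lt_dual p0mu mu1 rkl.
case/andP: p0mu => p0 pmu.
pose f s := lam * (p + s) - bern_cgf (mu - s) lam.
have cf : {for 0, continuous f}.
  apply: cvgB.
    by apply: cvgMl_tmp; apply: cvgD; [exact: cvg_cst|exact: cvg_id].
  rewrite /bern_cgf.
  apply: (@continuous_comp _ _ _ (fun s => bern_mgf (mu - s) lam) (@ln R)); last first.
    by apply: continuous_ln; rewrite bern_mgf_gt0// subr0 mu1 andbT; lra.
  rewrite /bern_mgf; have cm : {for (0:R), continuous (fun s => mu - s)}.
    by apply: cvgB; [exact: cvg_cst|exact: cvg_id].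
  apply: cvgD; last by apply: cvgMr_tmp.
  by apply: cvgB; [exact: cvg_cst|].
have fr : \forall s \near (0:R), r < f s.
  by apply: (cvgr_gt _ cf); rewrite /f addr0 subr0.
have fr' : \forall s \near (0:R)^'+, r < f s by exact: cvg_within fr.
have : \forall s \near (0:R)^'+, [/\ r < f s, 0 < s & s < mu].
  near=> s; split.
  - by near: s.
  - by near: s; exact: nbhs_right_gt.
  - by near: s; apply: nbhs_right_lt; lra.
move=> near_s; have [s [rs s0 smu]] := @filter_ex _ _ (at_right_proper_filter _) _ near_s.
by exists lam, (p + s), (mu - s); split => //; try lra; exact: ltW.
Unshelve. all: by end_near. Qed.

End Nets.

(** * Integrals of possibly non-measurable functions *)

Section Integral.
Context {R : realType}.
Variable P : probability R R.
Hypothesis P01 : P `[0%R, 1%R] = 1%E.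
Implicit Types f g : R -> \bar R.
Local Open Scope ereal_scope.

(* [integral] is a difference of suprema over simple functions, so monotonicity
   needs no measurability. *)
Lemma integral_mono f g : (forall y, f y <= g y) ->
  \int[P]_y f y <= \int[P]_y g y.
Proof.
move=> fg; rewrite integralE [leRHS]integralE; apply: leeB.
- rewrite !ge0_integralTE//; apply: le_ereal_sup => _ /= [h hf <-].
  by exists h => // y; rewrite (le_trans (hf y))// (@funepos_le _ _ setT f g)// inE.
- rewrite !ge0_integralTE//; apply: le_ereal_sup => _ /= [h hf <-].
  by exists h => // y; rewrite (le_trans (hf y))// (@funeneg_le _ _ setT f g)// inE.
Qed.

Lemma ae_supp : {ae P, forall y, `[0%R, 1%R]%classic y}.
Proof.
exists (~` `[0%R, 1%R]); split => //; first exact: measurableC.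
by rewrite probability_setC// P01 subee.
Qed.

Lemma integrable_id : P.-integrable setT (fun y : R => y%:E).
Proof.
have m1 : measurable_fun [set: R] (@EFin R) by exact/measurable_EFinP.
apply/integrableP; split => //.
rewrite (@ae_eq_integral _ _ _ P setT (fun y : R => `|y%:E| * (\1_`[0%R,1%R] y)%:E))//=.
- apply: (@le_lt_trans _ _ (\int[P]_y (cst 1 y))).
    apply: integral_mono => y /=; rewrite indicE.
    case: (boolP (y \in _)) => [|_]; last by rewrite mule0.
    by rewrite inE/= in_itv/= mule1 lee_fin => /andP[y0 y1]; rewrite ger0_norm.
  by rewrite integral_cst// mul1e (le_lt_trans (probability_le1 _ _))// ltry.
- exact: measurableT_comp.
- apply: emeasurable_funM; first exact: measurableT_comp.
  by apply/measurable_EFinP.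
- move: ae_supp; apply: filterS => y y01 _.
  by rewrite indicE mem_set// mule1.
Qed.

(** The minorant [g] is affine on the unit interval and the identity outside. It lies below [f]
    everywhere, as [integral_mono] requires, and is almost surely affine, so its integral depends on
    the mean alone. *)
Lemma integral_affine_le f (al be : R) : (forall y, y%:E <= f y) ->
  (forall y : R, (0 <= y <= 1)%R -> (al + be * y)%:E <= f y) ->
  (al + be * fine (\int[P]_y y%:E))%:E <= \int[P]_y f y.
Proof.
move=> fy fab.
pose A := `[0%R, 1%R]%classic : set R.
pose g (y : R) := (y + \1_A y * (al + be * y - y))%R.
apply: (@le_trans _ _ (\int[P]_y (g y)%:E)); last first.
  apply: integral_mono => y; rewrite /g indicE.
  case: (boolP (y \in A)) => [|_]; last by rewrite mul0r addr0.
  by rewrite inE /A/= in_itv/= mul1r addrC subrK; exact: fab.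
rewrite [leRHS](@ae_eq_integral _ _ _ P setT (fun y : R => al%:E + be%:E * y%:E))//.
- rewrite integralD//; last 2 first.
    exact: finite_measure_integrable_cst.
    by apply: integrableZl => //; exact: integrable_id.
  have -> : \int[P]_(_ in [set: R]) al%:E = al%:E.
    rewrite integral_cst//; transitivity (al%:E * 1); last exact: mule1.
    by congr (_ * _); exact: probability_setT.
  rewrite integralZl//; last exact: integrable_id.
  rewrite EFinD EFinM fineK//.
  by apply: integrable_fin_num => //; exact: integrable_id.
- apply/measurable_EFinP; apply: measurable_funD => //.
  apply: measurable_funM; first by apply: measurable_indic; exact: measurable_itv.
  apply: measurable_funB => //.
  by apply: measurable_funD => //; exact: measurable_funM.
- apply: emeasurable_funD => //; apply: emeasurable_funM => //.
- move: ae_supp; apply: filterS => y y01 _.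
  by rewrite /g indicE mem_set// mul1r addrC subrK.
Qed.

Lemma mean_ge0_le1 : (0 <= fine (\int[P]_y y%:E) <= 1)%R.
Proof.
have fin : \int[P]_y y%:E \is a fin_num.
  by apply: integrable_fin_num => //; exact: integrable_id.
have aeE : \int[P]_y y%:E = \int[P]_y (y * \1_`[0%R,1%R] y)%:E.
  apply: ae_eq_integral => //.
  - apply/measurable_EFinP; apply: measurable_funM => //.
  - by move: ae_supp; apply: filterS => y y01 _; rewrite indicE mem_set// mulr1.
have h y : (0 <= y * (\1_`[0%R,1%R] y : R) <= 1)%R.
  rewrite indicE; case: (boolP (y \in _)) => [|_]; last by rewrite mulr0 lexx ler01.
  by rewrite inE/= in_itv/= mulr1.
rewrite -2!lee_fin fineK// aeE; apply/andP; split.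
  by apply: integral_ge0 => y _; rewrite lee_fin; case/andP: (h y).
apply: (@le_trans _ _ (\int[P]_y (cst 1 y))).
  by apply: integral_mono => y; rewrite lee_fin; case/andP: (h y).
by rewrite integral_cst// mul1e probability_le1.
Qed.
End Integral.

(** * Potentials *)

Lemma kl_refl (R : realType) (p : R) : kl p p = 0%E.
Proof.
have t0 q : kl_term q q = (0 : \bar R)%E.
  by rewrite /kl_term; case: eqVneq => // q0; rewrite divff// ln1 mulr0.
by rewrite /kl !t0 adde0.
Qed.

(** The chord bound for the exponential, obtained here from duality at equal parameters, where the
    divergence vanishes. *)
Lemma expRM_le_bern_mgf (R : realType) (lam y : R) : 0 <= y <= 1 ->
  expR (lam * y) <= bern_mgf y lam.
Proof.
move=> y01; have := kl_ge_dual lam y01 y01.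
rewrite kl_refl lee_fin subr_le0 /bern_cgf => h.
by rewrite -[leRHS]lnK ?posrE ?bern_mgf_gt0// ler_expR.
Qed.

Section AffineDomination.
Context {R : realType}.
Implicit Types (F G : R -> R) (m v : R).

(* [F] is below, on [0, 1], an affine function whose value at [m] is [v]; hence
   the mean of [F] under any law on [0, 1] of mean [m] is at most [v]. *)
Definition affdom m F v :=
  exists be, forall y, 0 <= y <= 1 -> F y <= v + be * (y - m).

Lemma affdom_cst m F v : (forall y, F y <= v) -> affdom m F v.
Proof. by move=> Fv; exists 0 => y _; rewrite mul0r addr0. Qed.

Lemma affdomD m F G v w : affdom m F v -> affdom m G w ->
  affdom m (fun y => F y + G y) (v + w).
Proof.
move=> [b Fb] [c Gc]; exists (b + c) => y y01.
by rewrite mulrDl addrACA lerD ?Fb ?Gc.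
Qed.

Lemma affdomZ m F v k : 0 <= k -> affdom m F v ->
  affdom m (fun y => k * F y) (k * v).
Proof.
move=> k0 [b Fb]; exists (k * b) => y y01.
by rewrite -mulrA -mulrDr ler_wpM2l// Fb.
Qed.

Lemma affdom_sum m (I : eqType) (s : seq I) (Q : pred I) (F : I -> R -> R)
    (v : I -> R) : (forall i, i \in s -> Q i -> affdom m (F i) (v i)) ->
  affdom m (fun y => \sum_(i <- s | Q i) F i y) (\sum_(i <- s | Q i) v i).
Proof.
elim: s => [|i s IH] Fv.
  by apply: affdom_cst => y; rewrite !big_nil.
have {}IH : affdom m (fun y => \sum_(i <- s | Q i) F i y) (\sum_(i <- s | Q i) v i).
  by apply: IH => j js; apply: Fv; rewrite inE js orbT.
rewrite big_cons; case: ifPn => Qi.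
  have [b Hb] := affdomD (Fv i (mem_head _ _) Qi) IH; exists b => y y01.
  by rewrite big_cons Qi; exact: Hb.
by have [b Hb] := IH; exists b => y y01; rewrite big_cons (negbTE Qi); exact: Hb.
Qed.

End AffineDomination.

(** * Histories, expected rewards and exponential supermartingales *)

Section Bandit.
Context {R : realType} (K : nat) (nu : 'I_K -> probability R R).
Hypothesis Hsupp : forall a : 'I_K, nu a `[0%R, 1%R] = 1%E.
Notation hist := (history R K).
Notation mu := (arm_mean nu).
Implicit Types (h : hist) (a b : 'I_K) (lam c y : R).

Lemma arm_mean01 a : 0 <= mu a <= 1.
Proof. exact: mean_ge0_le1. Qed.

Definition bounded_history h := all (fun x : 'I_K * R => 0 <= x.2 <= 1) h.

Lemma bounded_history_rcons h a y : bounded_history h -> 0 <= y <= 1 ->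
  bounded_history (rcons h (a, y)).
Proof. by rewrite /bounded_history all_rcons /= => -> ->. Qed.

Definition total_reward h a : R := \sum_(x <- h | x.1 == a) x.2.

Lemma total_reward_rcons h a b y :
  total_reward (rcons h (a, y)) b = total_reward h b + (a == b)%:R * y.
Proof.
rewrite /total_reward -cats1 big_cat big_cons big_nil /=.
by case: eqP; rewrite ?mul1r ?mul0r ?addr0.
Qed.

Lemma npulls_rcons h a b y :
  npulls (rcons h (a, y)) b = (npulls h b + (a == b))%N.
Proof. by rewrite /npulls -cats1 count_cat /= addn0. Qed.

Lemma muhat_total h a : (npulls h a)%:R * muhat h a = total_reward h a.
Proof.
rewrite /muhat; case: (eqVneq (npulls h a) 0%N) => [N0|N0]; last first.
  by rewrite mulrC divfK// pnatr_eq0.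
rewrite N0 mul0r /total_reward big_seq_cond big_pred0// => x.
apply/negbTE/negP => /andP[xh xa]; move/eqP: N0; rewrite /npulls -leqn0 leqNgt.
by rewrite -has_count => /hasP; apply; exists x.
Qed.

Lemma muhat01 h a : bounded_history h -> 0 <= muhat h a <= 1.
Proof.
move=> /allP hb; have [N0|N0] := eqVneq (npulls h a) 0%N.
  by rewrite /muhat N0 eqxx lexx ler01.
have Np : 0 < (npulls h a)%:R :> R by rewrite ltr0n lt0n.
rewrite -(ler_pM2l Np) -[X in _ && X](ler_pM2l Np) muhat_total mulr0 mulr1.
rewrite /total_reward big_seq_cond; apply/andP; split.
  by apply: sumr_ge0 => x /andP[xh _]; case/andP: (hb _ xh).
apply: (@le_trans _ _ (\sum_(x <- h | (x \in h) && (x.1 == a)) 1)).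
  by apply: ler_sum => x /andP[xh _]; case/andP: (hb _ xh).
by rewrite -big_seq_cond big_const_seq iter_addr_0.
Qed.

(** No boundedness of [h] is assumed: the pointwise bound in [integral_affine_le] also concerns
    rewards outside the unit interval. *)
Lemma exp_reward_ge0 (pol : hist -> 'I_K -> R) n h :
  (forall h a, 0 <= pol h a) -> (0 <= exp_reward nu pol n h)%E.
Proof.
move=> pol0; elim: n h => [|n IH] h //=.
apply: sume_ge0 => a _; apply: mule_ge0; first by rewrite lee_fin.
have := @integral_affine_le _ _ (Hsupp a)
  (fun y => y%:E + exp_reward nu pol n (rcons h (a, y)))%E 0 0.
rewrite mul0r addr0; apply => y; first by rewrite leeDl.
by move=> /andP[y0 _]; rewrite mul0r addr0 adde_ge0.
Qed.

(* [Phi n h] dominates the cost of the next [n] rounds relative to the benchmark [B].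
   Only affine minorants get integrated, so that no measurability of [exp_reward]
   in the last reward is needed. *)
Lemma exp_reward_ge_potential (pol : hist -> 'I_K -> R) (B : R)
    (Phi : nat -> hist -> R) :
  (forall h a, 0 <= pol h a) ->
  (forall h, bounded_history h -> \sum_a pol h a = 1) ->
  (forall h, 0 <= Phi 0%N h) ->
  (forall n h, bounded_history h -> exists v : 'I_K -> R,
    (forall a, affdom (mu a) (fun y => Phi n (rcons h (a, y))) (v a)) /\
    \sum_a pol h a * (B - mu a + v a) <= Phi n.+1 h) ->
  forall n h, bounded_history h ->
  ((n%:R * B - Phi n h)%:E <= exp_reward nu pol n h)%E.
Proof.
move=> pol0 pol1 Phi0 step; elim=> [|n IH] h hb.
  by rewrite /= mul0r sub0r lee_fin oppr_le0.
have [v [vdom vstep]] := step n h hb.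
apply: (@le_trans _ _ (\sum_(a < K) (pol h a)%:E * (mu a + n%:R * B - v a)%:E)%E).
  under eq_bigr do rewrite -EFinM.
  rewrite sumEFin lee_fin.
  have -> : \sum_(a < K) pol h a * (mu a + n%:R * B - v a) =
    \sum_(a < K) (pol h a * (n.+1%:R * B) - pol h a * (B - mu a + v a)).
    by apply: eq_bigr => a _; rewrite -natr1; ring.
  by rewrite sumrB -mulr_suml pol1// mul1r lerB.
apply: lee_sum => a _; apply: lee_wpmul2l; first by rewrite lee_fin.
have [be vbe] := vdom a.
(* The integrand has an affine minorant of slope [1 - be]: 1 from the reward [y], [- be] from the
   majorant of [Phi]. Its value at [mu a] is the left-hand side. *)
have -> : mu a + n%:R * B - v a =
  (n%:R * B - v a + be * mu a) + (1 - be) * mu a by ring.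
apply: integral_affine_le => // y.
  by rewrite leeDl// exp_reward_ge0.
move=> y01; apply: (@le_trans _ _ (y%:E + (n%:R * B - Phi n (rcons h (a, y)))%:E)%E).
  by rewrite -EFinD lee_fin; have := vbe y y01; lra.
by rewrite leeD2l// IH// bounded_history_rcons.
Qed.

(* For [c = 0] this is the exponential supermartingale of the rewards of arm [b]. *)
Definition tilt b lam c h : R :=
  expR (lam * total_reward h b - (npulls h b)%:R * (bern_cgf (mu b) lam + c)).

(** By the chord bound, [expR (lam * y) / M] is below an affine function equal to 1 at the mean of
    the arm. Only the discount [expR (- c)] remains when [b] is pulled. *)
Lemma affdom_tilt a b lam c h :
  affdom (mu a) (fun y => tilt b lam c (rcons h (a, y)))
    (tilt b lam c h * (if a == b then expR (- c) else 1)).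
Proof.
have [<-|ab] := eqVneq a b; last first.
  apply: affdom_cst => y; rewrite /tilt total_reward_rcons npulls_rcons.
  by rewrite (negbTE ab) mul0r !addr0 addn0 mulr1.
set M := bern_mgf (mu a) lam.
have M0 : 0 < M by rewrite bern_mgf_gt0 ?arm_mean01.
exists (tilt a lam c h * expR (- c) * ((expR lam - 1) / M)) => y y01.
have -> : tilt a lam c (rcons h (a, y)) =
    tilt a lam c h * expR (- c) * (expR (lam * y) / M).
  rewrite /tilt total_reward_rcons npulls_rcons eqxx mul1r.
  rewrite /bern_cgf -/M -[M in RHS]lnK ?posrE// -expRN -!expRD.
  by congr expR; rewrite natrD expRK /=; ring.
set k := tilt a lam c h * expR (- c).
have -> : k + k * ((expR lam - 1) / M) * (y - mu a) =
    k * (1 + (expR lam - 1) / M * (y - mu a)) by ring.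
rewrite ler_wpM2l ?mulr_ge0 ?expR_ge0//.
have -> : 1 + (expR lam - 1) / M * (y - mu a) = bern_mgf y lam / M.
  by rewrite mulrAC -[X in X + _](@divff _ M) ?gt_eqF// -mulrDl /M /bern_mgf;
    congr (_ / _); ring.
by rewrite ler_pM2r ?invr_gt0// expRM_le_bern_mgf.
Qed.

(* As [pot * expR (- c) = pot - tilt], this potential pays [tilt] at each pull of [b]. *)
Definition pot b lam c h : R := tilt b lam c h / (1 - expR (- c)).

Lemma pot_ge0 b lam c h : 0 < c -> 0 <= pot b lam c h.
Proof.
move=> c0; rewrite divr_ge0 ?expR_ge0// subr_ge0 ltW// expR_lt1.
by rewrite oppr_lt0.
Qed.

Lemma affdom_pot a b lam c h : 0 < c ->
  affdom (mu a) (fun y => pot b lam c (rcons h (a, y)))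
    (pot b lam c h - (a == b)%:R * tilt b lam c h).
Proof.
move=> c0; have e1 : 0 < 1 - expR (- c) by rewrite subr_gt0 expR_lt1 oppr_lt0.
have ei0 : 0 <= (1 - expR (- c))^-1 by rewrite invr_ge0 ltW.
have [be H] := affdomZ ei0 (affdom_tilt a b lam c h).
exists be => y y01; rewrite /pot mulrC (le_trans (H y y01))// lerD2r.
case: eqP => _; rewrite ?mul1r ?mul0r.
  by rewrite le_eqVlt; apply/orP; left; apply/eqP; field; rewrite gt_eqF.
by rewrite mulr1 subr0 mulrC.
Qed.

End Bandit.

(** * The KL-MS policy *)

(** Makes the truncated difference [u - N] a potential that pays 1 for each pull made while
    [N < u]. *)
Lemma subn_addb_le (u N : nat) (b : bool) :
  (u - (N + b) + (b && (N < u)) <= u - N)%N.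
Proof. by case: b => /=; lia. Qed.

Section Policy.
Context {R : realType} (K : nat) (a0 : 'I_K).
Notation hist := (history R K).
Implicit Types (h : hist) (a b : 'I_K).

Lemma muhat_max_ge h a : muhat h a <= muhat_max a0 h.
Proof. exact: le_bigmax. Qed.

Lemma muhat_max_attained h : exists a, muhat_max a0 h = muhat h a.
Proof.
rewrite /muhat_max; elim/big_ind: _ => [|x y [a ->] [b ->]|a _].
- by exists a0.
- by case: (leP (muhat h a) (muhat h b)) => _; [exists b|exists a].
- by exists a.
Qed.

Lemma muhat_max01 h : bounded_history h -> 0 <= muhat_max a0 h <= 1.
Proof. by move=> hb; have [a ->] := muhat_max_attained h; exact: muhat01. Qed.

Lemma klms_weight_ge0 h a : 0 <= klms_weight a0 h a.
Proof. by rewrite /klms_weight; case: kl => // r; exact: expR_ge0. Qed.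

Lemma klms_weight_le1 h a : bounded_history h -> klms_weight a0 h a <= 1.
Proof.
move=> hb; have := kl_ge0 (muhat01 a hb) (muhat_max01 hb).
rewrite /klms_weight; case: kl => // r; rewrite lee_fin => r0.
by rewrite expR_le1 oppr_le0 mulr_ge0.
Qed.

(** An empirically best arm has divergence 0, hence weight 1. *)
Lemma klms_weight_sum_ge1 h : 1 <= \sum_b klms_weight a0 h b.
Proof.
have [a ma] := muhat_max_attained h.
rewrite (bigD1 a)//= {1}/klms_weight ma kl_refl /= mulr0 oppr0 expR0 lerDl.
by apply: sumr_ge0 => b _; exact: klms_weight_ge0.
Qed.

Lemma klms_policy_ge0 h a : 0 <= klms_policy a0 h a.
Proof.
rewrite /klms_policy; case: ifP => _; first by rewrite ler0n.
by rewrite divr_ge0 ?klms_weight_ge0// (le_trans _ (klms_weight_sum_ge1 h)).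
Qed.

Lemma klms_policy_sum h : \sum_a klms_policy a0 h a = 1.
Proof.
rewrite /klms_policy; case: ltnP => [hK|_]; last first.
  by rewrite -mulr_suml divff// lt0r_neq0// (lt_le_trans ltr01 (klms_weight_sum_ge1 h)).
rewrite (bigD1 (Ordinal hK))//= eqxx big1 => [|a]; first by rewrite addr0.
by rewrite -val_eqE /= => /negbTE ->.
Qed.

Lemma klms_policy_le_weight h a : (K <= size h)%N ->
  klms_policy a0 h a <= klms_weight a0 h a.
Proof.
move=> hK; rewrite /klms_policy ltnNge hK /=.
have W1 := klms_weight_sum_ge1 h; have W0 := lt_le_trans ltr01 W1.
by rewrite ler_pdivrMr// ler_peMr// klms_weight_ge0.
Qed.

Lemma klms_policy_le_ratio h a b (k : R) : bounded_history h -> (K <= size h)%N ->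
  1 <= klms_weight a0 h b * k ->
  klms_policy a0 h a <= klms_policy a0 h b * k.
Proof.
move=> hb hK bk; rewrite /klms_policy ltnNge hK /=.
have W1 := klms_weight_sum_ge1 h; have W0 := lt_le_trans ltr01 W1.
by rewrite mulrAC ler_pM2r ?invr_gt0// (le_trans (klms_weight_le1 _ hb)).
Qed.

End Policy.

(** * The potential for the pulls of one suboptimal arm *)

Section Pulls.
Context {R : realType} (K : nat) (nu : 'I_K -> probability R R) (a0 : 'I_K).
Hypothesis Hsupp : forall a : 'I_K, nu a `[0%R, 1%R] = 1%E.
Notation hist := (history R K).
Notation mu := (arm_mean nu).
Notation pol := (klms_policy a0).
Implicit Types (h : hist) (a b : 'I_K).

Let mu01 a : 0 <= mu a <= 1 := arm_mean01 Hsupp a.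

Section OneArm.
Variables (a : 'I_K) (u : nat) (tau x q d lam : R) (la ca : R) (L : seq (R * R)).
Hypotheses (tau0 : 0 <= tau) (q0 : 0 < q) (qmu : q < mu a0).
Hypotheses (lam0 : lam < 0) (d_dual : d <= lam * x - bern_cgf q lam).
Hypothesis u_large : expR (- (u%:R * d)) <= tau.
Hypotheses (d0 : 0 <= d) (la0 : 0 < la) (ca0 : 0 < ca).
Hypothesis ca_dual : ca <= la * x - bern_cgf (mu a) la.
Hypothesis L0 : forall lc, lc \in L -> 0 < lc.2.
Hypothesis L_dual : forall p, 0 <= p <= q -> exists2 lc, lc \in L &
  (kl p q <= (lc.1 * p - bern_cgf (mu a0) lc.1 - lc.2)%:E)%E.

Let q01 : 0 <= q <= 1.
Proof. by case/andP: (mu01 a0) => _; rewrite (ltW q0); exact/le_trans/ltW. Qed.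

(** Since [lam < 0], the dual value decreases in the empirical mean and increases in the empirical
    maximum. It is thus at least its value at [x] and [q], hence at least [d]. *)
Lemma klms_policy_le_weak h : bounded_history h -> (K <= size h)%N ->
  (u <= npulls h a)%N -> muhat h a <= x -> q <= muhat_max a0 h ->
  pol h a <= tau.
Proof.
move=> hb hK uN px qm.
apply: (le_trans (klms_policy_le_weight _ _ hK)); apply: le_trans u_large.
have := kl_ge_dual lam (muhat01 a hb) (muhat_max01 a0 hb).
rewrite /klms_weight; case: kl => [r| |]; rewrite ?leeNy_eq//.
rewrite lee_fin => dr; rewrite ler_expR lerN2.
apply: ler_pM => //; first by rewrite ler_nat.
apply: (le_trans d_dual); apply: le_trans dr; apply: lerB.
  by rewrite ler_nM2l.
rewrite /bern_cgf ler_ln ?posrE ?bern_mgf_gt0 ?muhat_max01//.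
have : expR lam < 1 by rewrite expR_lt1.
by rewrite /bern_mgf; nra.
Qed.

Lemma tilt_ge1 h : x <= muhat h a -> 1 <= tilt nu a la ca h.
Proof.
move=> xp; rewrite /tilt -muhat_total mulrCA -mulrBr -[leLHS]expR0 ler_expR mulr_ge0//.
have : la * x <= la * muhat h a by rewrite ler_pM2l.
by move: ca_dual; lra.
Qed.

(** As the maximum is below [q], the divergence in the weight is at most [kl p q], which some tilt
    of [L] dominates. In the product with that tilt the exponents add up to a nonnegative number,
    and the other tilts are nonnegative. *)
Lemma klms_weight_tilt_ge1 h : bounded_history h -> muhat_max a0 h < q ->
  1 <= klms_weight a0 h a0 * \sum_(lc <- L) tilt nu a0 lc.1 lc.2 h.
Proof.
move=> hb mq; set m := muhat_max a0 h in mq *; set p := muhat h a0.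
have pm : p <= m by exact: muhat_max_ge.
have m01 : 0 <= m <= 1 by exact: muhat_max01.
have p01 : 0 <= p <= 1 by exact: muhat01.
have [q0' q1] := andP q01.
have [lc lcL klpq] : exists2 lc, lc \in L &
  (kl p q <= (lc.1 * p - bern_cgf (mu a0) lc.1 - lc.2)%:E)%E.
  by apply: L_dual; lra.
have klpm : (kl p m <= kl p q)%E.
  have [m0|mN0] := eqVneq m 0.
    have -> : p = 0 by move: p01 pm; rewrite m0; lra.
    by rewrite m0 kl_refl kl_ge0//; lra.
  by apply/ltW/kl_lt; rewrite ?mq ?q1//; [case/andP: p01 => ->|
    rewrite lt_neqAle eq_sym mN0; case/andP: m01].
have := le_trans klpm klpq; have := kl_ge0 p01 m01.
rewrite /klms_weight -/m -/p; case: kl => // r; rewrite !lee_fin => r0 rle.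
rewrite (perm_big _ (perm_to_rem lcL)) big_cons /= mulrDr.
apply: (@le_trans _ _ (expR (- ((npulls h a0)%:R * r)) * tilt nu a0 lc.1 lc.2 h)).
  rewrite /tilt -muhat_total -/p -expRD -[leLHS]expR0 ler_expR.
  rewrite [lc.1 * _]mulrCA -mulrBr addrC -mulrBr mulr_ge0// subr_ge0.
  by rewrite opprD addrA.
rewrite lerDl mulr_ge0 ?expR_ge0// sumr_ge0// => i _.
exact: expR_ge0.
Qed.

(** One term for each way of bounding the probability of [a]. The term [tau] has no indicator, since
    it is paid at every round whatever the arm. *)
Definition arm_decrement h b : R :=
  ((b == a) && (npulls h a < u)%N)%:R + tau + (b == a)%:R * tilt nu a la ca h +
  (b == a0)%:R * \sum_(lc <- L) tilt nu a0 lc.1 lc.2 h.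

Definition arm_potential (n : nat) h : R :=
  (u - npulls h a)%N%:R + n%:R * tau + pot nu a la ca h +
  \sum_(lc <- L) pot nu a0 lc.1 lc.2 h.

Lemma arm_potential_ge0 n h : 0 <= arm_potential n h.
Proof using tau0 ca0 L0.
rewrite /arm_potential !addr_ge0 ?ler0n ?pot_ge0// ?mulr_ge0//.
rewrite big_seq_cond; apply: sumr_ge0 => lc /andP[lcL _].
by rewrite pot_ge0 ?L0.
Qed.

Lemma affdom_arm_potential n h b :
  affdom (mu b) (fun y => arm_potential n (rcons h (b, y)))
    (arm_potential n.+1 h - arm_decrement h b).
Proof using Hsupp ca0 L0.
set c1 := ((u - npulls h a)%N%:R - ((b == a) && (npulls h a < u)%N)%:R : R).
have h1 : affdom (mu b) (fun y => (u - npulls (rcons h (b, y)) a)%N%:R) c1.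
  apply: affdom_cst => y; rewrite /c1 npulls_rcons lerBrDr -natrD ler_nat.
  exact: subn_addb_le.
have h2 : affdom (mu b) (fun=> n%:R * tau) (n%:R * tau) by exact: affdom_cst.
have h3 := affdom_pot Hsupp b a la h ca0.
have h4 := @affdom_sum R (mu b) _ L xpredT _ _
  (fun lc lcL _ => affdom_pot Hsupp b a0 lc.1 h (L0 lcL)).
have [be H] := affdomD (affdomD (affdomD h1 h2) h3) h4.
exists be => y y01; apply: (le_trans (H y y01)); rewrite lerD2r.
rewrite le_eqVlt; apply/orP; left; apply/eqP.
rewrite /c1 /arm_potential /arm_decrement sumrB -mulr_sumr -natr1; ring.
Qed.

Lemma arm_decrement_ge0 h b : 0 <= arm_decrement h b.
Proof using tau0.
rewrite /arm_decrement !addr_ge0 ?ler0n ?mulr_ge0 ?ler0n ?expR_ge0//.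
by apply: sumr_ge0 => lc _; exact: expR_ge0.
Qed.

(** Averaging over the arm drawn turns each indicator of an arm into its probability. Of the four
    nonnegative terms obtained, one alone dominates [pol h a] in each case. *)
Lemma klms_policy_le_decrement h : bounded_history h -> (K <= size h)%N ->
  pol h a <= \sum_b pol h b * arm_decrement h b.
Proof.
move=> hb hK; have pol0 b : 0 <= pol h b by exact: klms_policy_ge0.
have S0 : 0 <= \sum_(lc <- L) tilt nu a0 lc.1 lc.2 h.
  by apply: sumr_ge0 => lc _; exact: expR_ge0.
have sumE : \sum_b pol h b * arm_decrement h b =
    pol h a * (npulls h a < u)%N%:R + tau + pol h a * tilt nu a la ca h +
    pol h a0 * \sum_(lc <- L) tilt nu a0 lc.1 lc.2 h.
  rewrite /arm_decrement; under eq_bigr do rewrite !mulrDr.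
  rewrite !big_split /= -mulr_suml klms_policy_sum mul1r.
  have pick c (B : bool) : \sum_b pol h b * ((b == c) && B)%:R = pol h c * B%:R.
    rewrite (bigD1 c)//= eqxx big1 ?addr0// => b /negbTE ->.
    by rewrite mulr0.
  have pick' c (F : R) : \sum_b pol h b * ((b == c)%:R * F) = pol h c * F.
    rewrite (bigD1 c)//= eqxx mul1r big1 ?addr0// => b /negbTE ->.
    by rewrite mul0r mulr0.
  by rewrite pick !pick'.
rewrite sumE.
have t0 : 0 <= pol h a * tilt nu a la ca h by rewrite mulr_ge0 ?expR_ge0.
have s0 : 0 <= pol h a0 * \sum_(lc <- L) tilt nu a0 lc.1 lc.2 h by rewrite mulr_ge0.
have n0 : 0 <= pol h a * (npulls h a < u)%N%:R by rewrite mulr_ge0.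
case: (ltnP (npulls h a) u) n0 => uN; rewrite ?mulr1 ?mulr0 => n0.
  by move: tau0; lra.
have [xp|px] := leP x (muhat h a).
  have : pol h a <= pol h a * tilt nu a la ca h by rewrite ler_peMr// tilt_ge1.
  by move: tau0; lra.
have [qm|mq] := leP q (muhat_max a0 h).
  by have := klms_policy_le_weak hb hK uN (ltW px) qm; lra.
have := klms_policy_le_ratio a hb hK (klms_weight_tilt_ge1 hb mq).
by move: tau0; lra.
Qed.

End OneArm.
End Pulls.

(** * Regret *)

Section Regret.
Context {R : realType} (K : nat) (nu : 'I_K -> probability R R) (a0 : 'I_K).
Hypothesis Hsupp : forall a : 'I_K, nu a `[0%R, 1%R] = 1%E.
Notation hist := (history R K).
Notation mu := (arm_mean nu).
Notation pol := (klms_policy a0).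
Implicit Types (h : hist) (a b : 'I_K).

(* [Psi n h] dominates the expected number of pulls of arm [a] in the next [n]
   rounds, except for those of the first [K] rounds of the game. *)
Definition pull_potential a (Psi : nat -> hist -> R) :=
  (forall h, 0 <= Psi 0%N h) /\
  forall n h, bounded_history h -> exists v : 'I_K -> R,
    (forall b, affdom (mu b) (fun y => Psi n (rcons h (b, y))) (v b)) /\
    \sum_b pol h b * v b + ((K <= size h)%N)%:R * pol h a <= Psi n.+1 h.

Definition pull_rate a : R :=
  match kl (mu a) (mu a0) with r%:E => (mu a0 - mu a) / r | _ => 0 end.

(** The choice of [d] makes the last inequality an equality. If the divergence is infinite the rate
    is 0 and any finite [d] is below it. *)
Lemma pull_rate_approx a eta : 0 < mu a0 - mu a -> 0 < eta ->
  exists2 d, 0 < d & (d%:E < kl (mu a) (mu a0))%E /\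
    (mu a0 - mu a) / d <= pull_rate a + eta.
Proof.
move=> D0 eta0; have kl0 : (0 < kl (mu a) (mu a0))%E.
  have /andP[m0 _] := arm_mean01 Hsupp a; have /andP[_ m1] := arm_mean01 Hsupp a0.
  by apply: kl_gt0 => //; rewrite m0 -subr_gt0.
have rate0 : 0 <= pull_rate a.
  rewrite /pull_rate; case: kl kl0 => // r; rewrite lte_fin => r0.
  by rewrite divr_ge0 ?ltW.
have re0 : 0 < pull_rate a + eta by rewrite ltr_wpDl.
exists ((mu a0 - mu a) / (pull_rate a + eta)); first by rewrite divr_gt0.
split; last by rewrite invf_div mulrC divfK// gt_eqF.
move: re0; rewrite /pull_rate; case: kl kl0 => // [r|] r0 re0; last by rewrite ltry.
rewrite lte_fin ltr_pdivrMr// mulrDr mulrC divfK ?gt_eqF// ?ltrDl ?mulr_gt0//.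
Qed.

Lemma exists_pull_potential a eta : 0 < mu a0 - mu a -> 0 < eta ->
  exists C : R, forall T : nat, (0 < T)%N ->
  exists2 Psi, pull_potential a Psi &
    (mu a0 - mu a) * Psi T [::] <= (pull_rate a + eta) * ln T%:R + C.
Proof.
move=> D0 eta0; have [d d0 [dkl rate]] := pull_rate_approx D0 eta0.
have /andP[m0 m1] := arm_mean01 Hsupp a.
have /andP[_ mu1] := arm_mean01 Hsupp a0.
have m01 : 0 <= mu a < mu a0 by rewrite m0 -subr_gt0.
have [lam [x [q [lam0 ax q0 qmu ddual]]]] := kl_dual_perturb m01 mu1 dkl.
have [|la la0 cax] := @bern_cgf_lt_mean _ (mu a) x _ m1; first by rewrite m0.
have [||L [L0 Ldual]] := @kl_le_max_dual _ q (mu a0); rewrite ?qmu//.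
pose ca := la * x - bern_cgf (mu a) la.
have ca0 : 0 < ca by rewrite subr_gt0.
pose C1 := pot nu a la ca [::] + \sum_(lc <- L) pot nu a0 lc.1 lc.2 [::].
(* The tilts, and so [C1], are fixed before [T]. The first gap pays for rounding [u] up, the 1 for
   [T] rounds at cost [T%:R^-1] each. *)
exists (mu a0 - mu a + (mu a0 - mu a) * (1 + C1)) => T T0.
have Tp : 0 < T%:R :> R by rewrite ltr0n.
(* The least integer above [ln T / d], so that [expR (- (u%:R * d))] is at most [T%:R^-1]. *)
pose z := ln T%:R / d; pose u := (Num.truncn z).+1.
have z0 : 0 <= z by rewrite divr_ge0 ?(ltW d0)// ln_ge0// ler1n.
have /andP[uz zu] := truncn_itv z0.
pose Psi := arm_potential nu a0 a u (T%:R^-1) la ca L.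
have tau0 : 0 <= T%:R^-1 :> R by rewrite invr_ge0 ltW.
exists Psi; first split.
- by move=> h; exact: arm_potential_ge0.
- move=> n h hb; exists (fun b => Psi n.+1 h - arm_decrement nu a0 a u T%:R^-1 la ca L h b).
  split=> [b|]; first exact: affdom_arm_potential.
  under eq_bigr do rewrite mulrBr.
  rewrite sumrB -mulr_suml klms_policy_sum mul1r -addrA gerDl addrC subr_le0.
  case: leqP => hK; last first.
    by rewrite mul0r sumr_ge0// => b _; rewrite mulr_ge0 ?klms_policy_ge0 ?arm_decrement_ge0.
  rewrite mul1r.
  apply: (@klms_policy_le_decrement _ _ _ _ Hsupp a u T%:R^-1 x q d lam) => //.
  + rewrite -[leRHS]lnK ?posrE ?invr_gt0// ler_expR lnV ?posrE// lerN2.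
    by rewrite -ler_pdivrMr// ltW.
  + exact: ltW.
have -> : Psi T [::] = u%:R + 1 + C1.
  rewrite /Psi /arm_potential /= subn0 divff ?gt_eqF// /C1; ring.
have uz1 : u%:R <= z + 1 by rewrite -natr1 lerD2r.
have : (mu a0 - mu a) * z <= (pull_rate a + eta) * ln T%:R.
  rewrite /z mulrCA mulrC ler_wpM2r//.
  by rewrite ln_ge0// ler1n.
have : (mu a0 - mu a) * u%:R <= (mu a0 - mu a) * (z + 1) by rewrite ler_pM2l.
set D := mu a0 - mu a; set l := (pull_rate a + eta) * _; lra.
Qed.

Lemma klms_reward_ge (Psi : 'I_K -> nat -> hist -> R) (T : nat) :
  (forall a, 0 < mu a0 - mu a -> pull_potential a (Psi a)) ->
  ((T%:R * mu a0 -
     (K%:R + \sum_(a < K | (0 < mu a0 - mu a)%R) (mu a0 - mu a) * Psi a T [::]))%:E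
   <= exp_reward nu pol T [::])%E.
Proof.
move=> HPsi.
(* Each round of the initial phase costs at most 1, paid by the first term; later rounds are paid by
   the pull potentials weighted by the gaps. *)
pose Phi n h := (K - size h)%N%:R +
  \sum_(a < K | 0 < mu a0 - mu a) (mu a0 - mu a) * Psi a n h.
have -> : K%:R + \sum_(a < K | (0 < mu a0 - mu a)%R) (mu a0 - mu a) * Psi a T [::] =
  Phi T [::] by rewrite /Phi subn0.
apply: (exp_reward_ge_potential Hsupp) => //.
- by move=> h a; exact: klms_policy_ge0.
- by move=> h _; exact: klms_policy_sum.
- move=> h; rewrite /Phi addr_ge0// sumr_ge0// => a D0.
  by rewrite mulr_ge0 ?(ltW D0)//; exact: (HPsi a D0).1.
move=> n h hb.
have /boolp.choice[v vP] : forall a, exists v : 'I_K -> R, 0 < mu a0 - mu a ->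
    (forall b, affdom (mu b) (fun y => Psi a n (rcons h (b, y))) (v b)) /\
    \sum_b pol h b * v b + ((K <= size h)%N)%:R * pol h a <= Psi a n.+1 h.
  move=> a; case: (ltP 0 (mu a0 - mu a)) => [D0|_]; last by exists (fun=> 0).
  by have [v Hv] := (HPsi a D0).2 n h hb; exists v.
exists (fun b => (K - (size h).+1)%N%:R +
  \sum_(a < K | 0 < mu a0 - mu a) (mu a0 - mu a) * v a b); split.
  move=> b; apply: affdomD.
    by apply: affdom_cst => y; rewrite size_rcons.
  apply: affdom_sum => a _ D0; apply: affdomZ; first exact: ltW.
  exact: (vP a D0).1.
have pol1 := klms_policy_sum a0 h.
have pol0 b : 0 <= pol h b by exact: klms_policy_ge0.
under eq_bigr do rewrite mulrDr [X in _ + X]mulrDr.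
rewrite !big_split /= -mulr_suml pol1 mul1r.
have -> : \sum_(i < K) pol h i * (\sum_(a < K | 0 < mu a0 - mu a) (mu a0 - mu a) * v a i)
  = \sum_(a < K | 0 < mu a0 - mu a) (mu a0 - mu a) * \sum_b pol h b * v a b.
  under eq_bigr do rewrite mulr_sumr.
  rewrite exchange_big /=; apply: eq_bigr => a _; rewrite mulr_sumr.
  by apply: eq_bigr => b _; rewrite mulrCA.
(* Arms whose gap is not positive can only lower the expected cost. *)
have gap : \sum_b pol h b * (mu a0 - mu b) <=
   \sum_(b | 0 < mu a0 - mu b) (mu a0 - mu b) * pol h b.
  rewrite [leRHS]big_mkcond; apply: ler_sum => b _; case: ltP => D0.
    by rewrite mulrC.
  by rewrite mulr_ge0_le0.
rewrite /Phi.
set G := fun b => (mu a0 - mu b) * pol h b in gap.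
set S := fun a => (mu a0 - mu a) * \sum_b pol h b * v a b.
case: (leqP K (size h)) => hK.
  have -> : (K - (size h).+1)%N = 0%N by lia.
  have -> : (K - size h)%N = 0%N by lia.
  rewrite !add0r; apply: (le_trans (lerD gap (lexx _))).
  rewrite -big_split /=; apply: ler_sum => a D0.
  have := (vP a D0).2; rewrite hK mul1r /G /S -mulrDr => vle.
  by rewrite ler_pM2l// addrC.
have -> : (K - size h)%N%:R = (K - (size h).+1)%N%:R + 1 :> R.
  by rewrite natr1; congr _%:R; lia.
have gap1 : \sum_b pol h b * (mu a0 - mu b) <= 1.
  rewrite -pol1; apply: ler_sum => b _; rewrite ler_piMr//.
  by have /andP[? _] := arm_mean01 Hsupp b; have /andP[_ ?] := arm_mean01 Hsupp a0; lra.
have : \sum_(a < K | 0 < mu a0 - mu a) S a <=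
   \sum_(a < K | 0 < mu a0 - mu a) (mu a0 - mu a) * Psi a n.+1 h.
  apply: ler_sum => a D0; rewrite ler_pM2l//.
  by have := (vP a D0).2; rewrite leqNgt hK mul0r addr0.
lra.
Qed.

End Regret.

(** * From the finite-horizon bound to the limit superior *)

Lemma limn_esup_le_near (R : realType) (f : nat -> \bar R) (N : nat) (c : \bar R) :
  (forall n, (N <= n)%N -> (f n <= c)%E) -> (limn_esup f <= c)%E.
Proof.
move=> fc; apply: (@le_trans _ _ (ereal_sup (f @` [set n | (N <= n)%N]))).
  by apply: ereal_inf_lbound; exists [set n | (N <= n)%N] => //; exists N.
by apply: ge_ereal_sup => _ /= [n Nn <-]; exact: fc.
Qed.

Lemma klms_regret_le (R : realType) (K : nat) (HK : (1 < K)%N)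
    (nu : 'I_K -> probability R R) (eta : R) :
  (forall a : 'I_K, nu a `[0%R, 1%R] = 1%E) -> 0 < eta ->
  exists C : R, forall T : nat, (0 < T)%N ->
  (klms_regret HK nu T <=
    ((lai_robbins_const HK nu + eta) * ln T%:R + C)%:E)%E.
Proof.
move=> Hsupp eta0; pose a0 := arm1 HK; pose mu := arm_mean nu.
have K0 : 0 < K%:R :> R by rewrite ltr0n ltnW.
(* Each arm is allowed an error [eta / K%:R] in its rate; at most [K] arms contribute. *)
have e0 : 0 < eta / K%:R by rewrite divr_gt0.
have /boolp.choice[C HC] : forall a : 'I_K, exists C : R, 0 < mu a0 - mu a ->
    forall T : nat, (0 < T)%N ->
    exists2 Psi, pull_potential nu a0 a Psi &
    (mu a0 - mu a) * Psi T [::] <= (pull_rate nu a0 a + eta / K%:R) * ln T%:R + C.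
  move=> a; case: (ltP 0 (mu a0 - mu a)) => [D0|_]; last by exists 0.
  by have [C HC] := exists_pull_potential Hsupp D0 e0; exists C.
exists (K%:R + \sum_(a < K | 0 < mu a0 - mu a) C a) => T T0.
have /boolp.choice[Psi HPsi] : forall a : 'I_K, exists Psi, 0 < mu a0 - mu a ->
    pull_potential nu a0 a Psi /\
    (mu a0 - mu a) * Psi T [::] <= (pull_rate nu a0 a + eta / K%:R) * ln T%:R + C a.
  move=> a; case: (ltP 0 (mu a0 - mu a)) => [D0|_]; last by exists (fun _ _ => 0).
  by have [Psi] := HC a D0 T T0; exists Psi.
have lnT0 : 0 <= ln T%:R :> R by rewrite ln_ge0// ler1n.
rewrite /klms_regret.
apply: le_trans (leeB (lexx _) (klms_reward_ge Hsupp T (fun a D0 => (HPsi a D0).1))) _.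
rewrite -EFinB lee_fin opprB addrC subrK addrCA lerD2l.
apply: (@le_trans _ _ (\sum_(a < K | 0 < mu a0 - mu a)
    ((pull_rate nu a0 a + eta / K%:R) * ln T%:R + C a))).
  by apply: ler_sum => a D0; exact: (HPsi a D0).2.
rewrite big_split /= lerD2r -mulr_suml ler_wpM2r// big_split /=.
rewrite lerD// big_mkcond /=.
apply: (@le_trans _ _ (\sum_(a < K) eta / K%:R)).
  by apply: ler_sum => a _; case: ifP => // _; exact: ltW.
by rewrite sumr_const card_ord -[_ *+ K]mulr_natr divfK// gt_eqF.
Qed.

Theorem theorem4 (R : realType) (K : nat) (HK : (1 < K)%N)
  (nu : 'I_K -> probability R R)
  (Hsupp : forall a : 'I_K, nu a `[0%R, 1%R] = 1%E)
  (Hsorted : forall i j : 'I_K, (i <= j)%N -> arm_mean nu j <= arm_mean nu i) :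
  (limn_esup (fun T : nat =>
      (klms_regret HK nu T * ((ln (T%:R : R))^-1)%:E)%E)
   <= (lai_robbins_const HK nu)%:E)%E.
Proof.
apply/lee_addgt0Pr => e e0.
have e20 : 0 < e / 2 by rewrite divr_gt0.
have [C HC] := klms_regret_le HK Hsupp e20.
(* Half of [e] is the slack in the rate; once [ln T >= t], the other half times [ln T] covers [C].
   The summand 1 keeps [ln T] positive. *)
pose t := 1 + `|C| / (e / 2).
apply: (@limn_esup_le_near _ _ (Num.truncn (expR t)).+1) => T NT.
have T0 : (0 < T)%N by exact: leq_trans NT.
have Tt : t <= ln T%:R.
  rewrite -ler_expR lnK ?posrE ?ltr0n//.
  by apply/ltW/(lt_le_trans (truncnS_gt _)); rewrite ler_nat.
have t1 : 1 <= t by rewrite lerDl divr_ge0// ltW.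
have lnT : 0 < ln T%:R :> R by rewrite (lt_le_trans _ Tt)// (lt_le_trans ltr01).
have li0 : (0 <= ((ln T%:R)^-1)%:E :> \bar R)%E by rewrite lee_fin invr_ge0 ltW.
apply: le_trans (lee_wpmul2r li0 (HC T T0)) _.
rewrite -EFinM -EFinD lee_fin ler_pdivrMr//.
have CT : C <= e / 2 * ln T%:R.
  apply: (le_trans (ler_norm C)); rewrite mulrC -ler_pdivrMr//.
  by apply: le_trans Tt; rewrite lerDr.
lra.
Qed.
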